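(* Let $d\ge 2$, let $c_d$ be the unique positive solution of $g_d(x)=d+1$ where $g_d(x)=(d+1)(x+1)e^{-x}+x(1-e^{-x})^{d+1}$, let $c>c_d$ and $p=\frac{c}{n}$. For $Y\in Y_d(n,p)$ define $$v(Y)=f_d(Y)+a(Y)+\sum_{j=0}^{d}\alpha_j(Y)(d-j)-\binom{n}{d},$$ where $f_d(Y)$ is the number of $d$-simplices of $Y$, $a(Y)$ is the number of $(d-1)$-simplices $\tau$ of $\Delta_{n-1}$ contained in no $d$-simplex of $Y$, and $\alpha_j(Y)$ is the number of $d$-simplices of $Y$ that contain exactly $d+1-j$ of their $(d-1)$-faces which are contained in exactly one $d$-simplex of $Y$. Then $$\lim_{n\to\infty}\Pr\big[Y\in Y_d(n,p): v(Y)\le 0\big]=0.$$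
   Context: $\Delta_{n-1}$ denotes the $(n-1)$-dimensional simplex on vertex set $[n]$, and $\Delta_{n-1}^{(i)}$ its $i$-skeleton. $Y_d(n,p)$ is the probability space of complexes $\Delta_{n-1}^{(d-1)}\subset Y\subset\Delta_{n-1}^{(d)}$ in which each $d$-simplex is included independently with probability $p$. *)

(* Defs.v *)
From HB Require Import structures.
From mathcomp Require Import all_boot all_order all_algebra.
From mathcomp Require Import all_classical all_reals all_analysis.
Set Implicit Arguments. Unset Strict Implicit. Unset Printing Implicit Defensive.
Import Order.TTheory GRing.Theory Num.Theory.
Local Open Scope ring_scope.

(* Vertex set [n] is 'I_n. A face of Delta_{n-1} with k vertices is a set
   s : {set 'I_n} with #|s| = k; an i-simplex has i+1 vertices.           *)
Definition ksets (n k : nat) : {set {set 'I_n}} :=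
  [set s : {set 'I_n} | #|s| == k].

(* A complex Y in Y_d(n,p) is determined by its set S of d-simplices,
   S \subset ksets n d.+1 (the full (d-1)-skeleton is always present).   *)

Definition sdeg n (S : {set {set 'I_n}}) (t : {set 'I_n}) : nat :=
  #|[set s in S | t \subset s]|.

Definition f_d n (S : {set {set 'I_n}}) : nat := #|S|.

Definition a_Y n d (S : {set {set 'I_n}}) : nat :=
  #|[set t in ksets n d | sdeg S t == 0%N]|.

Definition alpha_j n d (S : {set {set 'I_n}}) (j : nat) : nat :=
  #|[set s in S |
      #|[set t in ksets n d | (t \subset s) && (sdeg S t == 1%N)]| == (d.+1 - j)%N]|.

Definition v_Y n d (S : {set {set 'I_n}}) : int :=
  (f_d S + a_Y d S + \sum_(j < d.+1) alpha_j d S j * (d - j))%N%:Z - ('C(n, d))%:Z.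

Definition Pr_Yd (R : realType) n d (p : R) (E : pred {set {set 'I_n}}) : R :=
  \sum_(S : {set {set 'I_n}} | (S \subset ksets n d.+1) && E S)
     p ^+ #|S| * (1 - p) ^+ (#|ksets n d.+1| - #|S|).

Definition g_d (R : realType) (d : nat) (x : R) : R :=
  d.+1%:R * (x + 1) * expR (- x) + x * (1 - expR (- x)) ^+ d.+1.

(* Main.v *)
Require Import Defs.
From HB Require Import structures.
From mathcomp Require Import all_boot all_order all_algebra.
From mathcomp Require Import all_classical all_reals all_analysis.
From mathcomp Require Import ring lra zify.
Set Implicit Arguments.
Unset Strict Implicit.
Unset Printing Implicit Defensive.
Import Order.TTheory GRing.Theory Num.Theory.
Import numFieldNormedType.Exports.
Local Open Scope ring_scope.

(* Let A be the number of (d-1)-faces of degree at most 1 and Z the number of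
   d-simplices of Y without free faces.  A simplex with k free faces has weight
   k - 1 in the sum over j when k > 0, hence v = A + Z - C(n, d).  The degree
   of a fixed face is binomial, which gives E[A] exactly, and the conditions that
   s belongs to Y and that each facet of s lies in another simplex of Y are all
   increasing, so Harris' inequality bounds E[Z] from below.  In the limit
   E[v] / C(n, d) is at least g_d(c) / (d+1) - 1, which is positive since g_d
   tends to infinity and never takes the value d+1 beyond c_d.  Adding one simplex
   changes A + Z by at most d+2, so by Efron-Stein Var(v) = O(C(n, d)), and
   Chebyshev's inequality concludes. *)

(** * Random subsets: variance, correlation and tail inequalities *)

Section BernoulliExpectation.
Variables (R : realType) (T : finType) (p : R).
Implicit Types (s : seq T) (f g : {set T} -> R) (S : {set T}) (U : pred T).

(** The mean over a random subset of [s] is defined by conditioning on one element at a time, so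
    that each inequality below is an induction on coordinates. For duplicate-free [s] it is the
    usual weighted sum, by [bexpE]. *)
Fixpoint bexp s f : R :=
  if s is x :: s' then
    p * bexp s' (fun S => f (x |: S)) + (1 - p) * bexp s' f
  else f finset.set0.

Lemma eq_bexp s f g : (forall S, {subset S <= s} -> f S = g S) ->
  bexp s f = bexp s g.
Proof.
elim: s f g => [|x s IH] f g fg /=.
  by apply: fg => y; rewrite inE.
congr (_ * _ + _ * _); apply: IH => S Ss; apply: fg => y.
  by rewrite !inE => /orP[->//|/Ss ->]; rewrite orbT.
by move=> /Ss ys; rewrite inE ys orbT.
Qed.

Lemma bexpD s f g : bexp s (fun S => f S + g S) = bexp s f + bexp s g.
Proof. by elim: s f g => [//|x s IH] f g /=; rewrite !IH; ring. Qed.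

Lemma bexpZ s a f : bexp s (fun S => a * f S) = a * bexp s f.
Proof. by elim: s f => [//|x s IH] f /=; rewrite !IH; ring. Qed.

Lemma bexp_cst s a : bexp s (fun=> a) = a.
Proof. by elim: s => [//|x s IH] /=; rewrite !IH; ring. Qed.

Lemma bexp_sum s (I : Type) (r : seq I) (P : pred I) (F : I -> {set T} -> R) :
  bexp s (fun S => \sum_(i <- r | P i) F i S) =
  \sum_(i <- r | P i) bexp s (F i).
Proof.
elim: r => [|i r IH].
  rewrite big_nil -[RHS](bexp_cst s); apply: eq_bexp => S _.
  by rewrite big_nil.
rewrite big_cons -IH; case: ifP => Pi; last first.
  by apply: eq_bexp => S _; rewrite big_cons Pi.
by rewrite -bexpD; apply: eq_bexp => S _; rewrite big_cons Pi.
Qed.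

Lemma setU1_notin (x : T) S : x \notin S -> (x |: S) :\ x = S.
Proof.
move=> xS; apply/setP => y; rewrite !inE.
by case: eqVneq => //= ->; rewrite (negbTE xS).
Qed.

Lemma bexpE s f : uniq s ->
  bexp s f = \sum_(S : {set T} | S \subset [set x in s])
               p ^+ #|S| * (1 - p) ^+ (size s - #|S|) * f S.
Proof.
elim: s f => [|x s IH] f /=.
  move=> _; rewrite (big_pred1 finset.set0) => [|S].
    by rewrite cards0 !expr0 !mul1r.
  by rewrite /= -finset.subset0; congr (_ \subset _); apply/setP => y; rewrite !inE.
move=> /andP[xs us].
have xV : x \notin [set y in s] by rewrite inE.
(* The sets containing [x] are the [x |: S] with [S] supported in [s]; the other half is the sum for
   [s] with one more factor [1 - p]. *)
rewrite (bigID (fun S : {set T} => x \in S)) /=; congr (_ + _).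
  rewrite IH // big_distrr /=.
  rewrite [RHS](reindex_onto (fun S => x |: S) (fun S => S :\ x)) /=; last first.
    by move=> S /andP[_ xS]; rewrite finset.setD1K.
  apply: eq_big => S.
    rewrite setU11 andbT; apply/idP/idP => [/fintype.subsetP Ss|/andP[/fintype.subsetP Ss /eqP e]].
      rewrite setU1_notin ?eqxx ?andbT; last first.
        by apply/negP => /Ss; rewrite inE (negbTE xs).
      apply/fintype.subsetP => y; rewrite !inE.
      by case: eqVneq => //= _ /Ss; rewrite inE.
    apply/fintype.subsetP => y yS.
    have := Ss y; rewrite !inE yS orbT => /(_ isT) /orP[/eqP yx|//].
    by move: yS; rewrite -e yx !inE eqxx.
  move=> Ss.
  have xS : x \notin S by apply/negP => /(fintype.subsetP Ss); rewrite inE (negbTE xs).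
  by rewrite cardsU1 xS add1n subSS exprS !mulrA.
rewrite IH // big_distrr /=; apply: eq_big => S.
  apply/idP/idP => [/fintype.subsetP Ss|/andP[/fintype.subsetP Ss xS]].
    rewrite andbC; apply/andP; split.
      by apply/negP => /Ss; rewrite inE (negbTE xs).
    by apply/fintype.subsetP => y /Ss; rewrite !inE => ->; rewrite orbT.
  apply/fintype.subsetP => y yS; move: (Ss y yS); rewrite !inE => /orP[/eqP yx|//].
  by rewrite -yx yS in xS.
move=> Ss; rewrite subSn ?exprS; first by ring.
apply: (leq_trans (subset_leq_card Ss)).
by rewrite cardsE; apply: card_size.
Qed.

Lemma card_filterU1 U (x : T) S : x \notin S ->
  #|[set y in x |: S | U y]| = (U x + #|[set y in S | U y]|)%N.
Proof.
move=> xS; have [Ux|Ux] := boolP (U x).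
  have -> : [set y in x |: S | U y] = x |: [set y in S | U y].
    apply/setP => y; rewrite !inE; case: eqVneq => //= ->.
    by rewrite Ux.
  by rewrite cardsU1 !inE (negbTE xS).
congr #|pred_of_set _|; apply/setP => y; rewrite !inE; case: eqVneq => //= ->.
by rewrite (negbTE Ux) andbF.
Qed.

Lemma bexp_count0 s U : uniq s ->
  bexp s (fun S => (#|[set y in S | U y]| == 0%N)%:R) = (1 - p) ^+ count U s.
Proof.
elim: s => [|x s IH] /=.
  move=> _; suff -> : [set y in finset.set0 | U y] = finset.set0 by rewrite cards0.
  by apply/setP => y; rewrite !inE.
move=> /andP[xs us]; rewrite IH //.
under eq_bexp => S Ss.
  rewrite card_filterU1; last by apply/negP => /Ss; rewrite (negbTE xs).
  over.
case: (U x) => /=.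
  by rewrite bexp_cst mulr0 add0r exprS.
by rewrite IH // add0n; ring.
Qed.

(** The count is binomial, and the two terms are the probabilities of 0 and 1. The truncated
    predecessor at count 0 is harmless, since its coefficient vanishes. *)
Lemma bexp_count_le1 s U : uniq s ->
  bexp s (fun S => (#|[set y in S | U y]| <= 1)%N%:R) =
  (1 - p) ^+ count U s + (count U s)%:R * p * (1 - p) ^+ (count U s).-1.
Proof.
elim: s => [|x s IH] /=.
  move=> _; suff -> : [set y in finset.set0 | U y] = finset.set0.
    by rewrite cards0 expr0 /= !mul0r addr0.
  by apply/setP => y; rewrite !inE.
move=> /andP[xs us]; rewrite IH //.
under eq_bexp => S Ss.
  rewrite card_filterU1; last by apply/negP => /Ss; rewrite (negbTE xs).
  over.
case: (U x) => /=; last by rewrite IH //  add0n; ring.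
under eq_bexp do rewrite add1n ltnS leqn0.
rewrite bexp_count0 // add1n /=.
case: (count U s) => [|k] /=; first by rewrite expr0 expr1; ring.
by rewrite !exprS -[k.+2%:R]natr1; ring.
Qed.

Hypothesis p01 : 0 <= p <= 1.

Lemma le_bexp s f g : (forall S, {subset S <= s} -> f S <= g S) ->
  bexp s f <= bexp s g.
Proof.
move: p01 => /andP[p0 p1].
elim: s f g => [|x s IH] f g fg /=.
  by apply: fg => y; rewrite inE.
apply: lerD; (apply: ler_wpM2l; first by rewrite ?subr_ge0); apply: IH => S Ss;
  apply: fg => y.
  by rewrite !inE => /orP[->//|/Ss ->]; rewrite orbT.
by move=> /Ss ys; rewrite inE ys orbT.
Qed.

(* Efron-Stein: each coordinate contributes at most p (1 - p) K^2 to the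
   variance, because averaging over a coordinate preserves the differences. *)
Lemma bexp_variance_le s f (K : R) :
  (forall x S, x \in s -> `|f (x |: S) - f S| <= K) ->
  bexp s (fun S => f S ^+ 2) - bexp s f ^+ 2
    <= (size s)%:R * (p * (1 - p) * K ^+ 2).
Proof.
move: p01 => /andP[p0 p1].
elim: s f => [|x s IH] f fK /=; first by rewrite mul0r subrr.
have /= IH1 := IH (fun S => f (x |: S)).
have IH2 := IH f.
set A := bexp s (fun S => f (x |: S)) in IH1 *.
set B := bexp s f in IH2 *.
set A2 := bexp s (fun S => f (x |: S) ^+ 2) in IH1 *.
set B2 := bexp s (fun S => f S ^+ 2) in IH2 *.
have {}IH1 : A2 - A ^+ 2 <= (size s)%:R * (p * (1 - p) * K ^+ 2).
  apply: IH1 => y S ys; rewrite finset.setUCA; apply: fK.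
  by rewrite inE ys orbT.
have {}IH2 : B2 - B ^+ 2 <= (size s)%:R * (p * (1 - p) * K ^+ 2).
  by apply: IH2 => y S ys; apply: fK; rewrite inE ys orbT.
have AB : `|A - B| <= K.
  have e : A - B = bexp s (fun S => f (x |: S) - f S).
    rewrite /A /B -[X in _ - X]mul1r -mulNr -bexpZ -bexpD.
    by apply: eq_bexp => S _; rewrite mulN1r.
  rewrite e ler_norml; apply/andP; split.
    rewrite -[X in X <= _](bexp_cst s); apply: le_bexp => S _.
    by have := fK x S (mem_head _ _); rewrite ler_norml => /andP[].
  rewrite -[X in _ <= X](bexp_cst s); apply: le_bexp => S _.
  by have := fK x S (mem_head _ _); rewrite ler_norml => /andP[].
have AB2 : (A - B) ^+ 2 <= K ^+ 2.
  by rewrite -(real_normK (num_real _)) lerXn2r ?nnegrE //; apply: le_trans AB.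
have pq : 0 <= p * (1 - p) by rewrite mulr_ge0 ?subr_ge0.
rewrite -[(size s).+1%:R]natr1 [leRHS]mulrDl mul1r.
(* Law of total variance: the mean of the two conditional variances plus the variance of the
   conditional mean. *)
have -> : p * A2 + (1 - p) * B2 - (p * A + (1 - p) * B) ^+ 2 =
  p * (A2 - A ^+ 2) + (1 - p) * (B2 - B ^+ 2) + p * (1 - p) * (A - B) ^+ 2 by ring.
apply: lerD; last by rewrite ler_wpM2l.
set M := _%:R * _ in IH1 IH2 *.
have -> : M = p * M + (1 - p) * M by ring.
by apply: lerD; rewrite ler_wpM2l ?subr_ge0.
Qed.

Definition set_increasing f := forall S S', S \subset S' -> f S <= f S'.

(** Given the state of [x], the induction hypothesis applies. The covariance left over is
    [p * (1 - p)] times the product of the gains of the two means when [x] is added, both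
    nonnegative by monotonicity. *)
Lemma bexp_Harris s f g : set_increasing f -> set_increasing g ->
  bexp s f * bexp s g <= bexp s (fun S => f S * g S).
Proof.
move: p01 => /andP[p0 p1].
elim: s f g => [//|x s IH] f g fi gi /=.
have incr h : set_increasing h -> set_increasing (fun S => h (x |: S)).
  by move=> hi S S' SS'; apply: hi; rewrite finset.setUS.
have le h : set_increasing h -> bexp s h <= bexp s (fun S => h (x |: S)).
  by move=> hi; apply: le_bexp => S _; apply: hi; rewrite finset.subsetUr.
have h1 := IH _ _ (incr _ fi) (incr _ gi).
have h2 := IH _ _ fi gi.
have h3 := le _ fi; have h4 := le _ gi.
set Af := bexp s (fun S => f (x |: S)) in h1 h3 *.
set Ag := bexp s (fun S => g (x |: S)) in h1 h4 *.
set Bf := bexp s f in h2 h3 *.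
set Bg := bexp s g in h2 h4 *.
apply: (@le_trans _ _ (p * (Af * Ag) + (1 - p) * (Bf * Bg))); last first.
  by apply: lerD; rewrite ler_wpM2l ?subr_ge0.
rewrite -subr_ge0.
have -> : p * (Af * Ag) + (1 - p) * (Bf * Bg) -
   (p * Af + (1 - p) * Bf) * (p * Ag + (1 - p) * Bg) =
   p * (1 - p) * ((Af - Bf) * (Ag - Bg)) by ring.
by rewrite !mulr_ge0 ?subr_ge0.
Qed.

(** Nonnegativity keeps partial products increasing, so Harris' inequality can be applied one factor
    at a time. *)
Lemma bexp_Harris_prod s (I : Type) (r : seq I) (P : pred I)
    (F : I -> {set T} -> R) :
  (forall i, set_increasing (F i)) -> (forall i S, 0 <= F i S) ->
  \prod_(i <- r | P i) bexp s (F i) <= bexp s (fun S => \prod_(i <- r | P i) F i S).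
Proof.
move=> Fi F0; elim: r => [|i r IH].
  rewrite big_nil -[X in X <= _](bexp_cst s); apply: le_bexp => S _.
  by rewrite big_nil.
have -> : bexp s (fun S => \prod_(j <- i :: r | P j) F j S) =
    bexp s (fun S => if P i then F i S * \prod_(j <- r | P j) F j S
                     else \prod_(j <- r | P j) F j S).
  by apply: eq_bexp => S _; rewrite big_cons.
rewrite big_cons; case: ifP => Pi //.
apply: le_trans (_ : _ <= _) (bexp_Harris s (Fi i) _); last first.
  move=> S S' SS'; apply: ler_prod => j _; rewrite F0 /=; exact: Fi.
apply: ler_wpM2l => //.
by rewrite -(bexp_cst s 0); apply: le_bexp => S _.
Qed.

(** Where [f S <= 0], the squared deviation from the mean [mu] is at least [mu ^+ 2]. *)
Lemma bexp_Chebyshev s f : 0 < bexp s f ->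
  bexp s (fun S => (f S <= 0)%R%:R)
    <= (bexp s (fun S => f S ^+ 2) - bexp s f ^+ 2) / bexp s f ^+ 2.
Proof.
set mu := bexp s f => mu0.
rewrite ler_pdivlMr ?exprn_gt0 // mulrC -bexpZ.
have -> : bexp s (fun S => f S ^+ 2) - mu ^+ 2 =
    bexp s (fun S => (f S ^+ 2 + (- 2 * mu) * f S) + mu ^+ 2).
  by rewrite !bexpD bexpZ bexp_cst -/mu; ring.
apply: le_bexp => S _; have [fS|fS] := leP (f S) 0.
  by rewrite mulr1; nra.
by rewrite mulr0; have := sqr_ge0 (f S - mu); nra.
Qed.

End BernoulliExpectation.

(** * Face counts and the reformulation of v *)

Lemma card_sumb (T : finType) (A : {set T}) (P : pred T) :
  #|[set x in A | P x]| = (\sum_(x in A) P x)%N.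
Proof.
rewrite -sum1_card (eq_bigl (fun x => (x \in A) && P x)) => [|x]; last by rewrite inE.
by rewrite big_mkcondr /=; apply: eq_bigr => x _; case: (P x).
Qed.

Section Combinatorics.
Variables n d : nat.
Implicit Types (S : {set {set 'I_n}}) (s t : {set 'I_n}).

Definition lowdeg_faces S := [set t in ksets n d | (sdeg S t <= 1)%N].

(** A facet of a simplex of [S] has degree at least 1, so having no free face means that all facets
    have degree at least 2. Unlike equality to 1, this condition is monotone in [S]. *)
Definition inner_simplices S :=
  [set s in S | [forall t in ksets n d, (t \subset s) ==> (1 < sdeg S t)%N]].

Definition free_faces S s :=
  [set t in ksets n d | (t \subset s) && (sdeg S t == 1%N)].

Lemma card_ksets k : #|ksets n k| = 'C(n, k).
Proof. by rewrite /ksets card_draws card_ord. Qed.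

Lemma card_facets s : s \in ksets n d.+1 ->
  #|[set t in ksets n d | t \subset s]| = d.+1.
Proof.
rewrite inE => /eqP sd; rewrite -[RHS](binSn d) -sd -cards_draws.
by apply: eq_card => t; rewrite !inE andbC.
Qed.

(** A cofacet of [t] arises by adding one of the [n - d] vertices outside [t], and determines that
    vertex. *)
Lemma card_cofacets t : t \in ksets n d ->
  #|[set s in ksets n d.+1 | t \subset s]| = (n - d)%N.
Proof.
rewrite inE => /eqP td.
have -> : [set s in ksets n d.+1 | t \subset s] = [set x |: t | x in ~: t].
  apply/setP => s; rewrite !inE; apply/idP/imsetP => [/andP[/eqP sd ts]|[x xt ->]].
    have : #|s :\: t| = 1%N by rewrite cardsD (finset.setIidPr ts) sd td subSnn.
    move=> /eqP/cards1P[x xE]; exists x.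
      by have := finset.set11 x; rewrite -xE !inE => /andP[].
    rewrite -xE; apply/setP => y; rewrite !inE; case: (boolP (y \in t)) => //= yt.
      by rewrite (fintype.subsetP ts).
    by rewrite orbF.
  by move: xt; rewrite inE => xt; rewrite cardsU1 xt td add1n eqxx finset.subsetUr.
rewrite card_in_imset.
  by rewrite [LHS]cardsCs finset.setCK card_ord td.
move=> x y; rewrite !inE => xt yt xy.
have := finset.setU11 x t; rewrite xy !inE => /orP[/eqP//|].
by rewrite (negbTE xt).
Qed.

(** For [k > 0] only [j = d + 1 - k] is selected, with weight [k - 1]. For [k = 0] no [j <= d]
    qualifies, in agreement with the truncated predecessor. *)
Lemma free_faces_weight (k : nat) : (k <= d.+1)%N ->
  (\sum_(j < d.+1) (k == d.+1 - j)%N * (d - j) = k.-1)%N.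
Proof.
case: k => [_|k kd].
  by rewrite big1 // => j _; rewrite subSn // -ltnS.
have jd : (d - k < d.+1)%N by lia.
rewrite (bigD1 (Ordinal jd)) //= big1 => [|j].
  have -> : (k.+1 == d.+1 - (d - k))%N by lia.
  by lia.
rewrite -val_eqE /= => jk; have := ltn_ord j.
have -> : (k.+1 == d.+1 - j)%N = false by apply/negbTE; lia.
by [].
Qed.

(** Double counting of incidences: a face of degree 1 lies in exactly one simplex of [S]. *)
Lemma sum_free_faces S :
  (\sum_(s in S) #|free_faces S s| = #|[set t in ksets n d | sdeg S t == 1%N]|)%N.
Proof.
under eq_bigr do rewrite card_sumb.
rewrite exchange_big card_sumb; apply: eq_bigr => t _ /=.
have [e|e] := eqVneq (sdeg S t) 1%N.
  under eq_bigr do rewrite andbT.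
  by rewrite -card_sumb; exact: e.
by rewrite big1 // => s _; rewrite andbF.
Qed.

Lemma inner_simplicesE S :
  inner_simplices S = [set s in S | #|free_faces S s| == 0%N].
Proof.
apply/setP => s; rewrite !inE; case sS : (s \in S) => //=.
rewrite cards_eq0; apply/forall_inP/eqP => [h|h t td].
  apply/setP => t; rewrite !inE; apply/negbTE/negP => /andP[td /andP[ts]].
  have := h t; rewrite inE td ts => /(_ isT).
  by case: (sdeg S t) => [|[]].
apply/implyP => ts.
have := congr1 (fun A : {set {set 'I_n}} => t \in A) h.
rewrite !inE ts /=; rewrite inE in td; rewrite td /= => t1.
have : (0 < sdeg S t)%N by rewrite card_gt0; apply/set0Pn; exists s; rewrite inE sS.
by move: t1; case: (sdeg S t) => [|[]].
Qed.

(* A simplex with k > 0 free faces contributes 1 + (k - 1) = k, so the free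
   faces are counted once each, and a simplex without free faces contributes 1. *)
Lemma v_YE S : S \subset ksets n d.+1 ->
  v_Y d S = (#|lowdeg_faces S| + #|inner_simplices S|)%N%:Z - ('C(n, d))%:Z.
Proof.
move=> /fintype.subsetP SV; congr (_%:Z - _).
have -> : (\sum_(j < d.+1) alpha_j d S j * (d - j) =
           \sum_(s in S) #|free_faces S s|.-1)%N.
  have aE j : alpha_j d S j = (\sum_(s in S) (#|free_faces S s| == d.+1 - j))%N.
    exact: (card_sumb S (fun s => #|free_faces S s| == d.+1 - j)%N).
  transitivity (\sum_(j < d.+1) \sum_(s in S)
      (#|free_faces S s| == d.+1 - j) * (d - j))%N.
    by apply: eq_bigr => j _; rewrite aE big_distrl.
  rewrite exchange_big /=; apply: eq_bigr => s /SV sV.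
  rewrite -[RHS]free_faces_weight //.
  rewrite -(card_facets sV); apply: subset_leq_card.
  by apply/fintype.subsetP => t; rewrite !inE => /and3P[-> ->].
have -> : #|lowdeg_faces S| =
    (a_Y d S + #|[set t in ksets n d | sdeg S t == 1%N]|)%N.
  rewrite /lowdeg_faces /a_Y !card_sumb -big_split /=; apply: eq_bigr => t _.
  by case: (sdeg S t) => [|[]].
rewrite -sum_free_faces inner_simplicesE card_sumb /f_d -sum1_card.
have : (\sum_(s in S) 1 + \sum_(s in S) #|free_faces S s|.-1 =
    \sum_(s in S) #|free_faces S s| + \sum_(s in S) (#|free_faces S s| == 0))%N.
  by rewrite -!big_split; apply: eq_bigr => s _; case: #|_| => [|k] /=; lia.
by lia.
Qed.

End Combinatorics.

(** * Effect of adding one simplex *)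

Lemma leq_card_bigcup (I T : finType) (P : pred I) (F : I -> {set T}) :
  (#|(\bigcup_(i | P i) F i)%SET| <= \sum_(i | P i) #|F i|)%N.
Proof.
elim/big_rec2: _ => [|i k A _ Ak]; first by rewrite cards0.
by apply: leq_trans (leq_card_setU _ _) _; rewrite leq_add2l.
Qed.

Section BoundedDifferences.
Variables n d : nat.
Implicit Types (S : {set {set 'I_n}}) (s t : {set 'I_n}).

Lemma leq_sdeg S S' t : S \subset S' -> (sdeg S t <= sdeg S' t)%N.
Proof.
move=> /fintype.subsetP SS'; apply/subset_leq_card/fintype.subsetP => s.
by rewrite !inE => /andP[/SS' -> ->].
Qed.

Lemma sdegU1 S s t : ~~ (t \subset s) -> sdeg (s |: S) t = sdeg S t.
Proof.
move=> ts; apply: eq_card => u; rewrite !inE.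
by case: eqVneq => //= ->; rewrite (negbTE ts) andbF.
Qed.

(** Degrees can only grow, and only on the [d + 1] facets of [s]. *)
Lemma lowdeg_facesU1 S s : s \in ksets n d.+1 ->
  (#|lowdeg_faces d (s |: S)| <= #|lowdeg_faces d S|
     <= #|lowdeg_faces d (s |: S)| + d.+1)%N.
Proof.
move=> sV; apply/andP; split.
  apply/subset_leq_card/fintype.subsetP => t; rewrite !inE => /andP[-> /=].
  by apply: leq_trans; apply: leq_sdeg; rewrite finset.subsetUr.
rewrite -(card_facets sV); apply: leq_trans (leq_card_setU _ _).
apply/subset_leq_card/fintype.subsetP => t; rewrite !inE => /andP[-> /= t1].
by case: (boolP (t \subset s)) => ts; rewrite ?orbT ?sdegU1 // t1.
Qed.

(* A simplex of [S] that becomes inner when [s] is added is the only one of [S]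
   containing some facet of [s]. *)
Lemma inner_simplicesU1 S s : s \in ksets n d.+1 ->
  (#|inner_simplices d S| <= #|inner_simplices d (s |: S)|
     <= #|inner_simplices d S| + d.+2)%N.
Proof.
move=> sV; apply/andP; split.
  apply/subset_leq_card/fintype.subsetP => u; rewrite !inE => /andP[uS uP].
  rewrite uS orbT /=; apply/forall_inP => t td; apply/implyP => tu.
  have /forall_inP/(_ t td)/implyP/(_ tu) := uP.
  by move=> /leq_trans; apply; apply: leq_sdeg; rewrite finset.subsetUr.
pose B := (\bigcup_(t | (t \in [set t in ksets n d | t \subset s])
                   && (sdeg S t <= 1)%N) [set u in S | t \subset u])%SET.
have Bd : (#|B| <= d.+1)%N.
  apply: leq_trans (leq_card_bigcup _ _) _.
  rewrite -(card_facets sV) -sum1_card big_mkcondr /=; apply: leq_sum => t _.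
  by case: ifP.
(* The new simplex [s] may itself be inner; with the [d + 1] bound on [B] this gives [d + 2]. *)
apply: (@leq_trans #|s |: (inner_simplices d S :|: B)|); last first.
  rewrite cardsU1; apply: (@leq_trans (1 + (#|inner_simplices d S| + #|B|))%N).
    by apply: leq_add; [exact: leq_b1 | exact: leq_card_setU].
  by rewrite add1n addnS ltnS leq_add2l.
apply/subset_leq_card/fintype.subsetP => u; rewrite in_setU1 inE in_setU1 => /andP[].
case: eqVneq => //= _ uS uP; rewrite finset.in_setU orbC.
case: (boolP (u \in B)) => //= uB; rewrite inE uS /=.
apply/forall_inP => t td; apply/implyP => tu; rewrite ltnNge; apply/negP => t1.
have /forall_inP/(_ t td)/implyP/(_ tu) := uP.
have [ts|ts] := boolP (t \subset s); last by rewrite sdegU1 // ltnNge t1.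
move=> _; move/negP: uB; apply; apply/bigcupP; exists t; last by rewrite inE uS.
by rewrite t1 inE td ts.
Qed.

(** The two counts move in opposite directions, so the larger of the bounds [d + 1] and [d + 2]
    suffices instead of their sum. *)
Lemma lowdeg_inner_bounded_difference (R : realType) S s : s \in ksets n d.+1 ->
  `|(#|lowdeg_faces d (s |: S)| + #|inner_simplices d (s |: S)|)%N%:R
     - (#|lowdeg_faces d S| + #|inner_simplices d S|)%N%:R| <= d.+2%:R :> R.
Proof.
move=> sV; have := lowdeg_facesU1 S sV; have := inner_simplicesU1 S sV.
move: #|_| #|_| #|_| #|_| => a b a' b' /andP[h1 h2] /andP[h3 h4].
by rewrite ler_distl lerBlDr -!natrD !ler_nat; apply/andP; split; lia.
Qed.

End BoundedDifferences.

(** * Expected numbers of low-degree faces and of inner simplices *)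

Section Moments.
Variables (R : realType) (p : R).
Hypothesis p01 : 0 <= p <= 1.

Lemma count_enum (T : finType) (A : {set T}) (U : pred T) :
  count U (enum A) = #|[set x in A | U x]|.
Proof.
rewrite -sum1_count big_enum_cond -sum1_card.
by apply: eq_bigl => x; rewrite inE.
Qed.

Section HittingIndicator.
Variable T : finType.
Implicit Types (S : {set T}) (U : pred T).

(** The complement form lets the mean be read off from the probability of a zero count. *)
Definition hits U S : R := 1 - (#|[set y in S | U y]| == 0%N)%:R.

Lemma hits_increasing U : set_increasing (hits U).
Proof.
move=> S S' /fintype.subsetP SS'; rewrite /hits lerD2l lerN2 ler_nat.
case: (boolP (_ == 0%N)) => [|//]; rewrite cards_eq0 => /eqP e.
suff -> : [set y in S | U y] = finset.set0 by rewrite cards0.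
apply/setP => y; rewrite !inE; apply/negbTE/negP => /andP[/SS' yS' Uy].
by have := congr1 (fun A : {set T} => y \in A) e; rewrite !inE yS' Uy.
Qed.

Lemma hits_ge0 U S : 0 <= hits U S.
Proof. by rewrite /hits; case: (_ == _); rewrite ?subrr ?subr0 ?ler01. Qed.

Lemma hits_le1 U S : hits U S <= 1.
Proof. by rewrite /hits lerBlDr lerDl ler0n. Qed.

Lemma hits_neq0 U S : hits U S != 0 -> exists2 y, y \in S & U y.
Proof.
rewrite /hits; case: (boolP (_ == 0%N)) => [|h _]; first by rewrite subrr eqxx.
move: h; rewrite cards_eq0 => /set0Pn[y]; rewrite inE => /andP[yS Uy].
by exists y.
Qed.

Lemma bexp_hits (s : seq T) U : uniq s ->
  bexp p s (hits U) = 1 - (1 - p) ^+ count U s.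
Proof.
move=> us; rewrite -bexp_count0 //.
rewrite -[X in _ = _ - X]mul1r -mulNr -bexpZ -[X in _ = X + _](bexp_cst p s) -bexpD.
by apply: eq_bexp => S _; rewrite mulN1r.
Qed.

End HittingIndicator.

Variables n d : nat.
Let V := enum (ksets n d.+1).
Implicit Types (S : {set {set 'I_n}}) (s t : {set 'I_n}).

Lemma bexp_lowdeg_faces :
  bexp p V (fun S => #|lowdeg_faces d S|%:R) =
  'C(n, d)%:R * ((1 - p) ^+ (n - d) + (n - d)%:R * p * (1 - p) ^+ (n - d).-1).
Proof.
rewrite -(card_ksets n d) mulr_natl -sumr_const.
transitivity (bexp p V (fun S => \sum_(t in ksets n d) (sdeg S t <= 1)%N%:R)).
  by apply: eq_bexp => S _; rewrite /lowdeg_faces card_sumb natr_sum.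
rewrite bexp_sum; apply: eq_bigr => t td.
rewrite -(card_cofacets td) -count_enum -bexp_count_le1 //.
exact: enum_uniq.
Qed.

(** This brings the event into the product form that Harris' inequality takes: a simplex of [S]
    other than [s] over each facet, together with [s], makes the degree at least 2. *)
Lemma inner_simplices_hits S s :
  hits (pred1 s) S * \prod_(t in [set t in ksets n d | t \subset s])
     hits (fun u => (u != s) && (t \subset u)) S
  <= (s \in inner_simplices d S)%:R.
Proof.
case: (boolP (s \in inner_simplices d S)) => [_|].
  rewrite mulr_ile1 ?hits_ge0 ?hits_le1 ?prodr_ge0 ?Num.Theory.prodr_ile1 //=.
  - by move=> t _; rewrite hits_ge0.
  - by move=> t _; rewrite hits_ge0 hits_le1.
rewrite inE negb_and => h; rewrite le_eqVlt; apply/orP; left.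
rewrite mulf_eq0 -implyNb; apply/implyP => /hits_neq0[y + /eqP ys]; rewrite ys => sS.
move: h; rewrite sS /= => /forall_inPn[t td]; rewrite negb_imply -leqNgt => /andP[ts t1].
apply/prodf_eq0; exists t; first by rewrite inE td ts.
apply/negPn/negP => /hits_neq0[u uS /andP[us tu]].
move: t1; rewrite leqNgt => /negP; apply; apply/card_gt1P; exists u, s.
by rewrite !inE uS sS ts tu.
Qed.

(** Each of the [d + 1] facets of [s] has [n - d] cofacets, one of which is [s]. Some other one is
    present with probability [1 - (1 - p) ^+ (n - d).-1], and Harris' inequality multiplies these
    bounds. *)
Lemma bexp_inner_simplices :
  'C(n, d.+1)%:R * (p * (1 - (1 - p) ^+ (n - d).-1) ^+ d.+1) <=
  bexp p V (fun S => #|inner_simplices d S|%:R).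
Proof.
rewrite -(card_ksets n d.+1) mulr_natl -sumr_const.
apply: (@le_trans _ _ (bexp p V (fun S => \sum_(s in ksets n d.+1)
    (s \in inner_simplices d S)%:R))); last first.
  apply: le_bexp => // S _; rewrite -natr_sum ler_nat -card_sumb.
  by apply/subset_leq_card/fintype.subsetP => s; rewrite inE => /andP[].
rewrite bexp_sum; apply: ler_sum => s sV.
apply: le_trans (le_bexp p01 (fun S _ => inner_simplices_hits S s)).
apply: le_trans (_ : _ <= _) (bexp_Harris p01 V (@hits_increasing _ (pred1 s)) _);
  last first.
  move=> S S' SS'; apply: ler_prod => t _; rewrite hits_ge0 /=.
  exact: hits_increasing.
have uV : uniq V := enum_uniq _.
have -> : bexp p V (hits (pred1 s)) = p.
  rewrite bexp_hits // count_uniq_mem // mem_enum sV expr1.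
  by ring.
apply: ler_wpM2l; first by case/andP: p01.
apply: le_trans (_ : _ <= _) (bexp_Harris_prod p01 V _ _ _ _); last 2 first.
- by move=> t; apply: hits_increasing.
- by move=> t S; apply: hits_ge0.
rewrite -(card_facets sV) -prodr_const le_eqVlt; apply/orP; left; apply/eqP.
apply: eq_bigr => t; rewrite inE => /andP[td ts].
rewrite bexp_hits //; congr (1 - _ ^+ _).
rewrite count_enum -(card_cofacets td) (cardsD1 s) inE sV ts /=.
by apply: eq_card => u; rewrite !inE; case: eqVneq => //=; rewrite andbF.
Qed.

End Moments.

(** * Second-moment bound for nonpositive v *)

Section TailBound.
Variables (R : realType) (n d : nat) (p : R).

Lemma Pr_Yd_bexp (E : pred {set {set 'I_n}}) :
  Pr_Yd d p E = bexp p (enum (ksets n d.+1)) (fun S => (E S)%:R).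
Proof.
rewrite bexpE ?enum_uniq // set_enum -cardE /Pr_Yd big_mkcondr /=.
by apply: eq_bigr => S _; case: (E S); rewrite ?mulr1 ?mulr0.
Qed.

(* A lower bound for E[v] / C(n, d) when m = n - d. *)
Definition mean_density (m : nat) : R :=
  (1 - p) ^+ m + m%:R * p * (1 - p) ^+ m.-1
  + m%:R * p / d.+1%:R * (1 - (1 - p) ^+ m.-1) ^+ d.+1 - 1.

Hypothesis p01 : 0 <= p <= 1.

Lemma Pr_Yd_ge0 (E : pred {set {set 'I_n}}) : 0 <= Pr_Yd d p E.
Proof.
rewrite Pr_Yd_bexp -(bexp_cst p (enum (ksets n d.+1)) 0).
by apply: le_bexp => // S _; rewrite ler0n.
Qed.

Lemma bin_density : 'C(n, d.+1)%:R = 'C(n, d)%:R * ((n - d)%:R / d.+1%:R) :> R.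
Proof.
rewrite mulrA [X in X / _]mulrC -natrM -mul_bin_left natrM.
by rewrite mulrAC divff ?mul1r // pnatr_eq0.
Qed.

(** The variance is of order ['C(n, d.+1) * p], that is ['C(n, d)] times [(n - d) * p / (d + 1)],
    while the squared mean has order ['C(n, d) ^+ 2]; one binomial coefficient survives in the
    denominator. *)
Lemma Pr_v_Y_le0 : (0 < 'C(n, d))%N -> 0 < mean_density (n - d) ->
  Pr_Yd d p (fun S : {set {set 'I_n}} => v_Y d S <= 0) <=
  (n - d)%:R * p / d.+1%:R * d.+2%:R ^+ 2
    / ('C(n, d)%:R * mean_density (n - d) ^+ 2).
Proof.
move=> C0 h0; have /andP[p0 p1] := p01.
rewrite Pr_Yd_bexp; set V := enum _.
pose f (S : {set {set 'I_n}}) : R :=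
  #|lowdeg_faces d S|%:R + #|inner_simplices d S|%:R + - 'C(n, d)%:R.
have -> : bexp p V (fun S => (v_Y d S <= 0)%R%:R) = bexp p V (fun S => (f S <= 0)%R%:R).
  apply: eq_bexp => S SV; congr (_ (nat_of_bool _)).
  rewrite v_YE; last by apply/fintype.subsetP => s /SV; rewrite mem_enum.
  by rewrite /f subr_le0 lez_nat subr_le0 -natrD ler_nat.
have CR : 0 < 'C(n, d)%:R :> R by rewrite ltr0n.
have mean : 'C(n, d)%:R * mean_density (n - d) <= bexp p V f.
  rewrite /f !bexpD bexp_cst bexp_lowdeg_faces.
  rewrite /mean_density mulrBr mulr1 lerD2r mulrDr lerD2l.
  apply: le_trans (bexp_inner_simplices p01 n d).
  rewrite bin_density le_eqVlt; apply/orP; left; apply/eqP; ring.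
have low0 : 0 < 'C(n, d)%:R * mean_density (n - d) by rewrite mulr_gt0.
have mean0 := lt_le_trans low0 mean.
apply: (le_trans (bexp_Chebyshev p01 mean0)).
rewrite ler_pdivrMr ?exprn_gt0 //.
have var : bexp p V (fun S => f S ^+ 2) - bexp p V f ^+ 2 <=
    'C(n, d.+1)%:R * (p * d.+2%:R ^+ 2).
  apply: le_trans (bexp_variance_le p01 (K := d.+2%:R) _) _.
    move=> s S; rewrite mem_enum => sV.
    apply: le_trans (lowdeg_inner_bounded_difference R S sV).
    rewrite le_eqVlt; apply/orP; left; apply/eqP; congr (`|_|).
    by rewrite /f [in RHS]natrD [X in _ = _ - X]natrD; ring.
  rewrite -cardE card_ksets ler_wpM2l // ler_wpM2r ?exprn_ge0 //.
  by rewrite -[leRHS]mulr1 ler_wpM2l // lerBlDr lerDl.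
apply: (le_trans var).
(* The variance bound equals [X] times the square of the lower bound on the mean, which is then
   replaced by the mean itself. *)
set X := _ / _.
have X0 : 0 <= X.
  rewrite /X divr_ge0 ?mulr_ge0 ?invr_ge0 ?exprn_ge0 //; exact: ltW.
apply: (@le_trans _ _ (X * ('C(n, d)%:R * mean_density (n - d)) ^+ 2)); last first.
  by rewrite ler_wpM2l // lerXn2r ?nnegrE ?(ltW low0) ?(ltW mean0).
rewrite le_eqVlt; apply/orP; left; apply/eqP.
rewrite /X bin_density; field.
by rewrite !gt_eqF.
Qed.

End TailBound.

Local Open Scope classical_set_scope.
Local Open Scope ring_scope.

(** * Asymptotics for p = c/n and growth of g_d *)

Section Limits.
Variable R : realType.

(** Both sides come from [1 + y <= expR y]: the upper bound with [y = - x], the lower one with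
    [y = x / (1 - x)], for which [1 + y] is the inverse of [1 - x]. *)
Lemma expR_sub1_bounds (x : R) (m : nat) : 0 <= x < 1 ->
  expR (- (m%:R * x / (1 - x))) <= (1 - x) ^+ m <= expR (- (m%:R * x)).
Proof.
move=> /andP[x0 x1]; have y0 : 0 < 1 - x by rewrite subr_gt0.
rewrite -mulrA -!(mulrN m%:R) !expRM_natl; apply/andP; split.
  apply: lerXn2r; rewrite ?nnegrE ?expR_ge0 ?(ltW y0) // expRN.
  rewrite -[leRHS]invrK lef_pV2 ?posrE ?invr_gt0 ?expR_gt0 //.
  apply: le_trans (expR_ge1Dx _).
  by rewrite le_eqVlt; apply/orP; left; apply/eqP; field; rewrite gt_eqF.
by rewrite lerXn2r ?nnegrE ?expR_ge0 ?(ltW y0) // expR_ge1Dx.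
Qed.

Lemma cvg_invn : (n%:R^-1 : R) @[n --> \oo] --> (0 : R).
Proof.
apply/gtr0_cvgV0; last exact: cvgr_idn.
by near=> n; rewrite ltr0n; near: n; exact: nbhs_infty_gt.
Unshelve. all: end_near. Qed.

Lemma cvg_divn (c : R) : c / n%:R @[n --> \oo] --> (0 : R).
Proof. by rewrite -(mulr0 c); apply: cvgMl_tmp; exact: cvg_invn. Qed.

Lemma cvg_subn_divn (c : R) (k : nat) :
  (n - k)%:R * (c / n%:R) @[n --> \oo] --> c.
Proof.
(* The two sequences agree once [n] is positive and [k <= n], where the subtraction is not
   truncated. *)
have : c - k%:R * (c / n%:R) @[n --> \oo] --> c - k%:R * 0.
  by apply: cvgB; [exact: cvg_cst | apply: cvgMl_tmp; exact: cvg_divn].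
rewrite mulr0 subr0; apply: cvg_trans; apply: near_eq_cvg.
near=> n.
have n0 : n%:R != 0 :> R by rewrite pnatr_eq0 -lt0n; near: n; exact: nbhs_infty_gt.
have kn : (k <= n)%N by near: n; exact: nbhs_infty_ge.
by rewrite /= natrB //; field.
Unshelve. all: end_near. Qed.

(** Squeeze with [x = c / n] in [expR_sub1_bounds]: the extra denominator [1 - c / n] tends to 1, so
    both exponents tend to [- c]. *)
Lemma cvg_exprn_expR (c : R) (k : nat) : 0 < c ->
  (1 - c / n%:R) ^+ (n - k) @[n --> \oo] --> expR (- c).
Proof.
move=> c0.
have cvg1 : 1 - c / n%:R @[n --> \oo] --> 1 - (0 : R).
  by apply: cvgB; [exact: cvg_cst | exact: cvg_divn].
have lo : expR (- ((n - k)%:R * (c / n%:R) / (1 - c / n%:R))) @[n --> \oo] --> expR (- c).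
  apply: (@continuous_cvg _ R R _ _ _ expR); first exact: continuous_expR.
  apply: cvgN; rewrite -[X in _ --> X]divr1 -[X in _ / X]subr0.
  apply: cvgM; first exact: cvg_subn_divn.
  by apply: cvgV => //; rewrite subr0 oner_neq0.
have hi : expR (- ((n - k)%:R * (c / n%:R))) @[n --> \oo] --> expR (- c).
  apply: (@continuous_cvg _ R R _ _ _ expR); first exact: continuous_expR.
  by apply: cvgN; exact: cvg_subn_divn.
apply: (squeeze_cvgr _ lo hi).
near=> n; apply: expR_sub1_bounds.
have n0 : 0 < n%:R :> R by rewrite ltr0n; near: n; exact: nbhs_infty_gt.
rewrite divr_ge0 ?(ltW c0) ?(ltW n0) //= -subr_gt0.
by near: n; apply: (cvgr_gt _ cvg1); rewrite subr0.
Unshelve. all: end_near. Qed.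

Lemma cvg_exprn (f : nat -> R) (l : R) (k : nat) :
  f @ \oo --> l -> f n ^+ k @[n --> \oo] --> l ^+ k.
Proof.
move=> fl; apply: (@continuous_cvg _ R R _ _ f (fun x => x ^+ k)) => //.
exact: exprn_continuous.
Qed.

Lemma cvg_mean_density (c : R) (d : nat) : 0 < c ->
  mean_density d (c / n%:R) (n - d) @[n --> \oo] --> g_d d c / d.+1%:R - 1.
Proof.
move=> c0; rewrite /mean_density /g_d.
have -> : (d.+1%:R * (c + 1) * expR (- c) + c * (1 - expR (- c)) ^+ d.+1) / d.+1%:R - 1
  = expR (- c) + c * expR (- c) + c / d.+1%:R * (1 - expR (- c)) ^+ d.+1 - 1.
  by field; rewrite ?natr1 ?nat1r pnatr_eq0.
(* Here [(n - d).-1] is [n - d.+1], so the shift by one does not affect the limit. *)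
have low : (1 - c / n%:R) ^+ (n - d).-1 @[n --> \oo] --> expR (- c).
  by under eq_fun do rewrite -subnS; exact: cvg_exprn_expR.
have deg := @cvg_subn_divn c d.
apply: cvgB; last exact: cvg_cst.
apply: cvgD; last first.
  apply: cvgM; first exact: cvgMr_tmp.
  by apply: (@cvg_exprn (fun n => 1 - (1 - c / n%:R) ^+ (n - d).-1));
    apply: cvgB; [exact: cvg_cst | exact: low].
apply: cvgD; first exact: cvg_exprn_expR.
exact: cvgM.
Qed.

Lemma continuous_g_d (d : nat) : continuous (@g_d R d).
Proof.
move=> x; have e : expR (- y) @[y --> x] --> expR (- x).
  apply: (@continuous_cvg _ R R _ _ _ expR); first exact: continuous_expR.
  by apply: cvgN; exact: cvg_id.
apply: cvgD; last first.
  apply: cvgM; first exact: cvg_id.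
  apply: (@continuous_cvg _ R R _ _ (fun y => 1 - expR (- y)) (fun x => x ^+ d.+1)).
    exact: exprn_continuous.
  by apply: cvgB; [exact: cvg_cst | exact: e].
apply: cvgM; last exact: e.
by apply: cvgMl_tmp; apply: cvgD; [exact: cvg_id | exact: cvg_cst].
Qed.

(** Only the second term of [g_d] is kept; there [1 - expR (- y)] is at least 1/2, because
    [expR y >= 1 + y >= 2]. *)
Lemma g_d_ge (d : nat) (y : R) : 1 <= y -> y / 2 ^+ d.+1 <= g_d d y.
Proof.
move=> y1; have y0 : 0 <= y by apply: le_trans y1.
have e2 : expR (- y) <= 2^-1.
  rewrite expRN lef_pV2 ?posrE ?expR_gt0 //.
  by apply: le_trans (expR_ge1Dx _); lra.
rewrite /g_d -[leLHS]add0r lerD //.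
  by rewrite !mulr_ge0 ?addr_ge0 ?expR_ge0.
by rewrite ler_wpM2l // -exprVn lerXn2r ?nnegrE; lra.
Qed.

(* [g_d] tends to infinity, so it would take the value [d + 1] again beyond [cd]
   if it were at most [d + 1] at some [c > cd]. *)
Lemma g_d_gt (d : nat) (cd c : R) : 0 < cd ->
  (forall x : R, 0 < x -> g_d d x = d.+1%:R -> x = cd) ->
  cd < c -> d.+1%:R < g_d d c.
Proof.
move=> cd0 uniq_cd cdc; rewrite ltNge; apply/negP => gc.
have P0 : 1 <= 2 ^+ d.+1 :> R by rewrite exprn_ege1 // ler1n.
(* This point lies beyond [c] and 1, and is large enough that [g_d_ge] gives a value of at least
   [d + 1]. *)
pose y := c + 1 + d.+1%:R * 2 ^+ d.+1.
have D0 : 0 <= d.+1%:R * 2 ^+ d.+1 :> R by rewrite mulr_ge0 // exprn_ge0.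
have cy : c <= y by rewrite /y; lra.
have gy : d.+1%:R <= g_d d y.
  apply: le_trans (g_d_ge _ _); last by rewrite /y; lra.
  by rewrite ler_pdivlMr ?(lt_le_trans ltr01) // /y; lra.
have [||x] := @IVT R (g_d d) c y d.+1%:R cy.
- by apply: continuous_subspaceT; exact: continuous_g_d.
- by rewrite ge_min le_max gc gy orbT.
rewrite in_itv /= => /andP[cx _] gx.
have := uniq_cd x (lt_trans cd0 (lt_le_trans cdc cx)) gx.
by move=> xcd; move: cx; rewrite xcd leNgt cdc.
Qed.

(** From [d * 'C(n, d) = n * 'C(n.-1, d.-1) >= n]. *)
Lemma invr_bin_le (n d : nat) : (0 < d <= n)%N ->
  'C(n, d)%:R^-1 <= d%:R / n%:R :> R.
Proof.
case: d => [//|d]; case: n => [//|n] /=; rewrite ltnS => dn.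
have C0 : 0 < 'C(n.+1, d.+1)%:R :> R by rewrite ltr0n bin_gt0.
rewrite ler_pdivlMr ?ltr0n // mulrC ler_pdivrMr // -natrM ler_nat.
by rewrite -mul_bin_diag /= leq_pmulr // bin_gt0.
Qed.

End Limits.

(** * Vanishing of the tail bound at p = c/n *)

Theorem theorem5 (R : realType) (d : nat) (hd : (2 <= d)%N) (cd c : R)
  (hcd0 : 0 < cd) (hcd : g_d d cd = d.+1%:R)
  (hcd_uniq : forall x : R, 0 < x -> g_d d x = d.+1%:R -> x = cd)
  (hc : cd < c) :
  (fun n : nat => Pr_Yd d (c / n%:R) (fun S : {set {set 'I_n}} => v_Y d S <= 0))
    @ \oo --> (0 : R).
Proof.
have c0 : 0 < c by apply: lt_trans hc.
have l0 : 0 < g_d d c / d.+1%:R - 1.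
  by rewrite subr_gt0 ltr_pdivlMr ?ltr0n // mul1r (g_d_gt hcd0 hcd_uniq hc).
have dens := @cvg_mean_density R c d c0.
set l := _ - 1 in l0 dens.
(* [K] is the limit of the Chebyshev bound times ['C(n, d)]; bounding the inverse of ['C(n, d)] by
   [d / n] supplies the factor that tends to 0. *)
set K : R := c / d.+1%:R * d.+2%:R ^+ 2 / l ^+ 2.
have hi : (n - d)%:R * (c / n%:R) / d.+1%:R * d.+2%:R ^+ 2
      / mean_density d (c / n%:R) (n - d) ^+ 2 * (d%:R / n%:R) @[n --> \oo] --> (0 : R).
  rewrite -(mulr0 K); apply: cvgM; last exact: cvg_divn.
  apply: cvgM.
    by do 2 apply: cvgMr_tmp; exact: cvg_subn_divn.
  apply: cvgV; first by rewrite expf_neq0 // gt_eqF.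
  by apply: (@cvg_exprn R (fun n => mean_density d (c / n%:R) (n - d))).
apply: (squeeze_cvgr _ (@cvg_cst _ 0 _ _ _) hi).
near=> n.
have n0 : 0 < n%:R :> R by rewrite ltr0n; near: n; exact: nbhs_infty_gt.
(* The ratio [c / n] is a probability only from [n >= c] on, which suffices for the limit. *)
have p01 : 0 <= c / n%:R <= 1.
  rewrite divr_ge0 ?(ltW c0) ?(ltW n0) //= ler_pdivrMr // mul1r.
  by near: n; exact: nbhs_infty_ger.
have dn : (d <= n)%N by near: n; exact: nbhs_infty_ge.
have h0 : 0 < mean_density d (c / n%:R) (n - d).
  by near: n; exact: (cvgr_gt _ dens).
rewrite Pr_Yd_ge0 //=.
apply: le_trans (Pr_v_Y_le0 p01 _ h0) _; first by rewrite bin_gt0.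
have swap (x a b : R) : x / (a * b) = x / b * a^-1.
  by rewrite invfM [a^-1 * _]mulrC mulrA.
rewrite swap ler_wpM2l //.
  have /andP[p0 _] := p01.
  by rewrite !mulr_ge0 ?invr_ge0 ?exprn_ge0 // ltW.
by apply: invr_bin_le; rewrite dn andbT (leq_trans _ hd).
Unshelve. all: end_near. Qed.
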